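(* Let $d\in\{2,3\}$, let $E>0$ be fixed, $\kappa=\sqrt E$, and let $k\in\mathbb{S}^{d-1}_\kappa$ be a fixed incident vector. Let $\nu=\sum_{j=1}^{n}\delta_{\alpha_j}(x-y_j)$ be a multipoint potential of Bethe–Peierls–Thomas–Fermi type in $\mathbb{R}^d$ (with $\alpha_j\in\mathbb{C}$ and $y_1,\dots,y_n\in\mathbb{R}^d$ mutually distinct) whose matrix $A(\kappa)$ satisfies $\det A(\kappa)\ne0$, and let $f^+$ be its scattering amplitude. If $f^+(k,l)=0$ for all $l\in\mathbb{S}^{d-1}_\kappa$, then $\nu\equiv0$, i.e. $n=0$ (there are no scatterers).
   Context: Notation: $\mathbb{S}^{d-1}_\kappa=\{x\in\mathbb{R}^d:|x|=\kappa\}$. Multipoint potentials. A multipoint potential of Bethe–Peierls–Thomas–Fermi type in $\mathbb{R}^d$, $d=2,3$, is a formal sum $\nu(x)=\sum_{j=1}^n\delta_{\alpha_j}(x-y_j)$, $\alpha_j\in\mathbb{C}$, $y_j\in\mathbb{R}^d$ mutually distinct; it is identified with the finite set of pairs $\{(y_j,\alpha_j)\}$. The case $\nu\equiv0$ is the case $n=0$. A function $\psi$ solves $-\Delta\psi+\nu\psi=E\psi$ if $-\Delta\psi=E\psi$ on $\mathbb{R}^d\setminus\{y_1,\dots,y_n\}$ and, as $x\to y_j$: for $d=2$, $\psi(x)=\psi_{j,-1}\ln|x-y_j|+\psi_{j,0}+O(|x-y_j|)$ with $\psi_{j,0}=(-2\pi\alpha_j-\ln2+\gamma)\psi_{j,-1}$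 ($\gamma$ is Euler's constant); for $d=3$, $\psi(x)=\psi_{j,-1}/|x-y_j|+\psi_{j,0}+O(|x-y_j|)$ with $4\pi\alpha_j\psi_{j,-1}=\psi_{j,0}$. Scattering amplitude. Let $\kappa=\sqrt E>0$. For $k\in\mathbb{S}^{d-1}_\kappa$ the scattering eigenfunction is the solution $\psi^+(x,k)=e^{ik\cdot x}+\psi^{sc}(x,k)$ with $|x|^{(d-1)/2}(\partial_{|x|}-i\kappa)\psi^{sc}\to0$ as $|x|\to\infty$ uniformly in $x/|x|$, and the scattering amplitude $f^+$ on $\mathbb{S}^{d-1}_\kappa\times\mathbb{S}^{d-1}_\kappa$ is defined by $\psi^{sc}(x,k)=\frac{e^{i\kappa|x|}}{|x|^{(d-1)/2}}f^+(k,\kappa x/|x|)+O(|x|^{-(d+1)/2})$. Explicitly (these known formulas may be taken as the definition of $\psi^+$ and $f^+$): let $$G^+(x,\kappa)=-\tfrac i4H_0^1(\kappa|x|)\ (d=2),\qquad G^+(x,\kappa)=-\frac{e^{i\kappa|x|}}{4\pi|x|}\ (d=3),$$ where $H_0^1$ is the zeroth-order Hankel function of the first kind. Let $A(\kappa)$ be the $n\times n$ matrix with $A_{j,j}(\kappa)=\alpha_j-\frac1{4\pi}(\pi i-2\ln\kappa)$ if $d=2$, $A_{j,j}(\kappa)=\alpha_j-\frac{i\kappa}{4\pi}$ if $d=3$, and $A_{j,j'}(\kappa)=G^+(y_j-y_{j'},\kappa)$ for $j\ne j'$. Assuming $\det A(\kappa)\ne0$ (for $n=0$ this condition is void), let $q(k)=(q_1(k),\dots,q_n(k))^t$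 be the solution of $A(\kappa)q(k)=-(e^{ik\cdot y_1},\dots,e^{ik\cdot y_n})^t$. Then, for $k,l\in\mathbb{S}^{d-1}_\kappa$, $$\psi^+(x,k)=e^{ik\cdot x}+\sum_{j=1}^nq_j(k)G^+(x-y_j,\kappa),\qquad f^+(k,l)=\frac{c(d,\kappa)}{(2\pi)^d}\sum_{j=1}^nq_j(k)e^{-il\cdot y_j},$$ with $c(d,\kappa)=-\pi i(\sqrt{2\pi}e^{-i\pi/4})^{d-1}\kappa^{(d-3)/2}$. *)

(* Defs.v *)
From HB Require Import structures.
From mathcomp Require Import all_boot all_order all_algebra.
From mathcomp Require Import complex.
From mathcomp Require Import all_classical all_reals all_analysis.

Set Implicit Arguments.
Unset Strict Implicit.
Unset Printing Implicit Defensive.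

Import Order.TTheory GRing.Theory Num.Theory.
Import numFieldNormedType.Exports.

Local Open Scope classical_set_scope.
Local Open Scope ring_scope.
Local Open Scope complex_scope.

(* The library norm `|x| on row vectors is the sup norm, hence the explicit
   Euclidean structure on 'rV[R]_d. *)
Definition dotp (R : realType) (d : nat) (x y : 'rV[R]_d) : R :=
  \sum_(i < d) x 0 i * y 0 i.

Definition enorm (R : realType) (d : nat) (x : 'rV[R]_d) : R :=
  Num.sqrt (dotp x x).

Definition esphere (R : realType) (d : nat) (kappa : R) : set 'rV[R]_d :=
  [set x | enorm x = kappa].

(* exp (i t) for real t *)
Definition expi (R : realType) (t : R) : R[i] := cos t +i* sin t.

(* [series harmonic n] is 1 + 1/2 + ... + 1/n. *)
Definition euler_gamma (R : realType) : R :=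
  limn (fun n : nat => series (@harmonic R) n - ln (n%:R : R)).

(* Power series of the Bessel functions of order zero of the first and second
   kind (DLMF 10.2.2 and 10.8.2). *)
Definition besselJ0 (R : realType) (x : R) : R :=
  limn (series (fun m : nat =>
    (-1) ^+ m / (m`!)%:R ^+ 2 * (x / 2) ^+ m.*2)).

(* As the logarithmic term shows, only meaningful for x > 0. *)
Definition besselY0 (R : realType) (x : R) : R :=
  2 / pi * (ln (x / 2) + euler_gamma R) * besselJ0 x +
  2 / pi * limn (series (fun m : nat =>
    (-1) ^+ m.+1 * series (@harmonic R) m / (m`!)%:R ^+ 2
      * (x / 2) ^+ m.*2)).

Definition hankelH01 (R : realType) (x : R) : R[i] :=
  besselJ0 x +i* besselY0 x.

(* In the definitions depending on the dimension, the [else] branch is the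
   three-dimensional formula: they are meant for d = 2 or d = 3 only. *)
Definition green (R : realType) (d : nat) (kappa : R) (x : 'rV[R]_d) : R[i] :=
  if d == 2%N then - ('i%C / 4) * hankelH01 (kappa * enorm x)
  else - (expi (kappa * enorm x) / (4 * pi * enorm x)%:C).

Definition scat_mx (R : realType) (d n : nat) (kappa : R)
    (alpha : 'I_n -> R[i]) (y : 'I_n -> 'rV[R]_d) : 'M[R[i]]_n :=
  \matrix_(j, j')
    if j == j' then
      if d == 2%N then
        alpha j - (1 / (4 * pi))%:C * (pi%:C * 'i%C - (2 * ln kappa)%:C)
      else alpha j - 'i%C * (kappa / (4 * pi))%:C
    else green kappa (y j - y j').

(* The solution q(k) of A(kappa) q(k) = - (exp (i k.y_j))_j, unique when
   det A(kappa) <> 0. *)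
Definition scat_coef (R : realType) (d n : nat) (kappa : R)
    (alpha : 'I_n -> R[i]) (y : 'I_n -> 'rV[R]_d) (k : 'rV[R]_d)
    : 'cV[R[i]]_n :=
  invmx (scat_mx kappa alpha y) *m - \col_j expi (dotp k (y j)).

Lemma scat_coefP (R : realType) (d n : nat) (kappa : R)
    (alpha : 'I_n -> R[i]) (y : 'I_n -> 'rV[R]_d) (k : 'rV[R]_d) :
  \det (scat_mx kappa alpha y) != 0 ->
  scat_mx kappa alpha y *m scat_coef kappa alpha y k
    = - \col_j expi (dotp k (y j)).
Proof. by move=> A0; rewrite mulKVmx // unitmxE unitfE. Qed.

Definition amp_const (R : realType) (d : nat) (kappa : R) : R[i] :=
  - (pi%:C * 'i%C) * ((Num.sqrt (2 * pi))%:C * expi (- (pi / 4))) ^+ (d - 1)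
    * (kappa `^ ((d%:R - 3) / 2))%:C.

Definition scat_amp (R : realType) (d n : nat) (kappa : R)
    (alpha : 'I_n -> R[i]) (y : 'I_n -> 'rV[R]_d) (k l : 'rV[R]_d) : R[i] :=
  amp_const d kappa / ((2 * pi) ^+ d)%:C
    * \sum_(j < n) scat_coef kappa alpha y k j 0 * expi (- dotp l (y j)).

(* Main.v *)
(* If the amplitude vanishes on the sphere, so do the coefficients q_j, because
   the plane waves exp(-i l.y_j) are linearly independent on the sphere; then
   A q = -(exp(i k.y_j))_j, whose entries are nonzero, forces n = 0.
   For the independence, restrict to a great circle in whose plane the y_j have
   distinct projections.  There the plane waves are exp(i h_j(t)) with
   h_j(t) = a_j cos t + b_j sin t, and one shows by induction on the number of
   terms that they are independent even over the polynomials in z = exp(i t):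
   after dividing by the first exponential, operators d/dt - i m kill its
   polynomial coefficient one power of z at a time, while on the other terms
   they are injective, since z h_j'(t) is a quadratic polynomial in z with nonzero
   leading coefficient. *)

Require Import Defs.
From mathcomp Require Import all_boot all_order all_algebra.
From mathcomp Require Import complex.
From mathcomp Require Import all_classical all_reals all_analysis.
From mathcomp Require Import ring.

Set Implicit Arguments.
Unset Strict Implicit.
Unset Printing Implicit Defensive.

Import Order.TTheory GRing.Theory Num.Theory.
Import numFieldNormedType.Exports.

Local Open Scope classical_set_scope.
Local Open Scope ring_scope.
Local Open Scope complex_scope.

(** * Componentwise differentiation of complex-valued functions of a real variable *)

Definition is_cderive (R : realType) (x : R) (f : R -> R[i]) (df : R[i]) :=
  is_derive x 1 (fun t => complex.Re (f t)) (complex.Re df) /\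
  is_derive x 1 (fun t => complex.Im (f t)) (complex.Im df).

Section ComplexDerivative.
Variables (R : realType) (x : R).
Implicit Types (f g : R -> R[i]) (h : R -> R).

Lemma is_cderive_unique f df df' :
  is_cderive x f df -> is_cderive x f df' -> df = df'.
Proof.
move=> [r1 i1] [r2 i2]; apply/eqP; rewrite eq_complex.
by rewrite -(@derive_val _ _ _ _ _ _ _ r1) -(@derive_val _ _ _ _ _ _ _ r2)
           -(@derive_val _ _ _ _ _ _ _ i1) -(@derive_val _ _ _ _ _ _ _ i2) !eqxx.
Qed.

Lemma is_cderive_cst (c : R[i]) : is_cderive x (fun=> c) 0.
Proof. by split; exact: is_derive_cst. Qed.

Lemma is_cderiveD f g df dg : is_cderive x f df -> is_cderive x g dg ->
  is_cderive x (fun t => f t + g t) (df + dg).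
Proof.
move=> [r1 i1] [r2 i2].
have E (p : R[i] -> R) (pD : forall a b, p (a + b) = p a + p b) :
  (fun t => p (f t + g t)) = (fun t => p (f t)) + (fun t => p (g t)).
  by apply/funext => t; rewrite pD.
split; rewrite E ?raddfD; try exact: is_deriveD; exact: raddfD.
Qed.

Lemma is_cderiveM f g df dg : is_cderive x f df -> is_cderive x g dg ->
  is_cderive x (fun t => f t * g t) (df * g x + f x * dg).
Proof.
move=> [r1 i1] [r2 i2]; split.
- have -> : (fun t => complex.Re (f t * g t)) =
    (fun t => complex.Re (f t)) * (fun t => complex.Re (g t)) -
    (fun t => complex.Im (f t)) * (fun t => complex.Im (g t)).
    by apply/funext => t /=; rewrite !fctE; case: (f t) (g t) => ? ? [].
  apply: is_derive_eq; rewrite /GRing.scale /=.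
  case: (f x) (g x) df dg {r1 i1 r2 i2} => ? ? [? ?] [? ?] [? ?] /=; ring.
- have -> : (fun t => complex.Im (f t * g t)) =
    (fun t => complex.Re (f t)) * (fun t => complex.Im (g t)) +
    (fun t => complex.Im (f t)) * (fun t => complex.Re (g t)).
    by apply/funext => t /=; rewrite !fctE; case: (f t) (g t) => ? ? [].
  apply: is_derive_eq; rewrite /GRing.scale /=.
  case: (f x) (g x) df dg {r1 i1 r2 i2} => ? ? [? ?] [? ?] [? ?] /=; ring.
Qed.

Lemma is_cderive_sum (n : nat) (F : 'I_n -> R -> R[i]) (dF : 'I_n -> R[i]) :
  (forall i, is_cderive x (F i) (dF i)) ->
  is_cderive x (fun t => \sum_(i < n) F i t) (\sum_(i < n) dF i).
Proof.
elim: n F dF => [|n IH] F dF H.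
  rewrite big_ord0; under eq_fun do rewrite big_ord0; exact: is_cderive_cst.
rewrite big_ord_recl; under eq_fun do rewrite big_ord_recl.
by apply: is_cderiveD => //; apply: IH.
Qed.

Lemma is_cderive_expi h (dh : R) : is_derive x 1 h dh ->
  is_cderive x (fun t => expi (h t)) ('i%C * dh%:C * expi (h x)).
Proof.
move=> Dh; split => /=.
- have := is_derive1_comp (is_derive_cos (h x)) Dh.
  by move/is_derive_eq; apply; rewrite /GRing.scale /=; ring.
- have := is_derive1_comp (is_derive_sin (h x)) Dh.
  by move/is_derive_eq; apply; rewrite /GRing.scale /=; ring.
Qed.

Lemma is_cderive_horner_expi (p : {poly R[i]}) :
  is_cderive x (fun t => p.[expi t]) ('i%C * expi x * p^`().[expi x]).
Proof.
elim/poly_ind: p => [|p c IH].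
  rewrite deriv0 horner0 mulr0; under eq_fun do rewrite horner0.
  exact: is_cderive_cst.
under eq_fun do rewrite hornerMXaddC.
rewrite derivMXaddC hornerD hornerMX.
have De := is_cderive_expi (is_derive_id x 1).
have := is_cderiveD (is_cderiveM IH De) (is_cderive_cst c).
set u := (X in is_cderive _ _ X -> _); set v := (X in _ -> is_cderive _ _ X).
suff -> : u = v by [].
by rewrite /u /v; ring.
Qed.

End ComplexDerivative.

(** * The function exp(it) and polynomials in it *)

Lemma expiD (R : realType) (s t : R) : expi (s + t) = expi s * expi t.
Proof. by rewrite /expi cosD sinD; simpc; rewrite [cos s * sin t + _]addrC. Qed.

Lemma expi0 (R : realType) : expi 0 = 1 :> R[i].
Proof. by rewrite /expi cos0 sin0. Qed.

Lemma expi_neq0 (R : realType) (t : R) : expi t != 0.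
Proof.
apply/eqP => e0; have := expiD t (- t).
by rewrite subrr expi0 e0 mul0r => /eqP; rewrite oner_eq0.
Qed.

Lemma poly_eq0_inj (F : idomainType) (p : {poly F}) (f : nat -> F) :
  injective f -> (forall k, p.[f k] = 0) -> p = 0.
Proof.
move=> finj p0; apply/eqP/negPn/negP => pN0.
have := @max_poly_roots _ p [seq f k | k <- iota 0 (size p)] pN0.
rewrite size_map size_iota ltnn map_inj_uniq ?iota_uniq // => H.
suff: false by []; apply: H => //.
by apply/allP => _ /mapP[k _ ->]; rewrite rootE p0.
Qed.

(** The angles 1/(k+1) lie in [0, pi], where cos is injective, so [p] has infinitely many distinct
    roots. *)
Lemma horner_expi_eq0 (R : realType) (p : {poly R[i]}) :
  (forall t, p.[expi t] = 0) -> p = 0.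
Proof.
move=> p0; apply: (@poly_eq0_inj _ p (fun k => expi (k.+1%:R : R)^-1)) => //.
move=> j k [cE _].
have mem (m : nat) : (m.+1%:R : R)^-1 \in `[0, pi].
  rewrite in_itv /= invr_ge0 ler0n /=.
  rewrite (@le_trans _ _ 1) ?invf_le1 ?ltr0Sn ?ler1n //.
  by rewrite (le_trans _ (pi_ge2 R)) // ler1n.
by have /invr_inj/eqP := cos_inj (mem j) (mem k) cE; rewrite eqr_nat eqSS => /eqP.
Qed.

(** * Plane waves on a circle and their linear independence *)

Definition circle_phase (R : realType) (w : R[i]) (t : R) : R :=
  complex.Re w * cos t + complex.Im w * sin t.

Lemma circle_phaseD (R : realType) (v w : R[i]) (t : R) :
  circle_phase (v + w) t = circle_phase v t + circle_phase w t.
Proof. by rewrite /circle_phase !raddfD /=; ring. Qed.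

Lemma circle_phase0 (R : realType) (t : R) : circle_phase 0 t = 0.
Proof. by rewrite /circle_phase !raddf0 !mul0r addr0. Qed.

(** Since -i(a + ib) = b - ia, packing the two coefficients into one complex number turns d/dt into
    multiplication by -i. *)
Lemma is_derive_circle_phase (R : realType) (w : R[i]) (t : R) :
  is_derive t 1 (circle_phase w) (circle_phase (- 'i%C * w) t).
Proof.
rewrite /circle_phase.
apply: is_derive_eq.
rewrite /GRing.scale /=; case: w => a b /=; ring.
Qed.

(* The derivative of [circle_phase w] at [t], times [expi t], as a polynomial
   in [expi t]. *)
Definition phase_poly (R : realType) (w : R[i]) : {poly R[i]} :=
  let: a +i* b := w in
  (b / 2 +i* (a / 2)) *: 'X^2 + (b / 2 +i* (- (a / 2)))%:P.

Lemma phase_poly0 (R : realType) : phase_poly 0 = 0 :> {poly R[i]}.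
Proof.
rewrite /phase_poly /= !mul0r oppr0 -[0 +i* 0]/(0 : R[i]).
by rewrite scale0r polyC0 addr0.
Qed.

Lemma horner_phase_poly (R : realType) (w : R[i]) (t : R) :
  (phase_poly w).[expi t] = expi t * (circle_phase (- 'i%C * w) t)%:C.
Proof.
case: w => a b; rewrite /phase_poly !hornerE /circle_phase /expi.
apply/eqP; rewrite eq_complex /=.
have := cos2Dsin2 t; rewrite !expr2 => /(canRL (addrK _)) E.
by apply/andP; split; apply/eqP; field: E.
Qed.

(* Up to the factor [i / z] with [z = expi t], the operator [d/dt - i m] maps
   [p(z) exp(i circle_phase w t)] to [wave_poly m w p (z) exp(i circle_phase w t)]. *)
Definition wave_poly (R : realType) (m : nat) (w : R[i]) (p : {poly R[i]}) :
    {poly R[i]} :=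
  'X * ('X * p^`() - p *+ m) + phase_poly w * p.

(** The bracket on the right is the product rule for p(z) exp(ih), minus im times this function; the
    factor z makes z h' a polynomial. *)
Lemma wave_polyE (R : realType) (m : nat) (w : R[i]) (p : {poly R[i]}) (t : R) :
  'i%C * ((wave_poly m w p).[expi t] * expi (circle_phase w t)) = expi t *
  ('i%C * expi t * p^`().[expi t] * expi (circle_phase w t) +
   p.[expi t] * ('i%C * (circle_phase (- 'i%C * w) t)%:C * expi (circle_phase w t))
   - 'i%C * m%:R * (p.[expi t] * expi (circle_phase w t))).
Proof.
rewrite /wave_poly !(hornerD, hornerN, hornerM, hornerX, hornerMn).
rewrite horner_phase_poly -mulr_natl; ring.
Qed.

Lemma wave_poly_relation (R : realType) (n m : nat) (w : 'I_n -> R[i])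
    (p : 'I_n -> {poly R[i]}) :
  (forall t, \sum_(i < n) (p i).[expi t] * expi (circle_phase (w i) t) = 0) ->
  forall t, \sum_(i < n)
    (wave_poly m (w i) (p i)).[expi t] * expi (circle_phase (w i) t) = 0.
Proof.
move=> p0 t; apply: (@mulfI _ 'i%C); first by rewrite eq_complex /= oner_eq0 andbF.
rewrite mulr0 mulr_sumr; under eq_bigr do rewrite wave_polyE.
rewrite -mulr_sumr sumrB -mulr_sumr p0 mulr0 subr0.
(* The remaining sum is the derivative of the zero function, hence zero by uniqueness. *)
have := is_cderive_sum (fun i => is_cderiveM (is_cderive_horner_expi t (p i))
  (is_cderive_expi (is_derive_circle_phase (w i) t))).
move/is_cderive_unique => /(_ 0) -> //; first by rewrite mulr0.
under eq_fun do rewrite p0; exact: is_cderive_cst.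
Qed.

(* For [w != 0], [wave_poly] raises the degree of a nonzero [p] by exactly 2. *)
Lemma wave_poly_eq0 (R : realType) (m : nat) (w : R[i]) (p : {poly R[i]}) :
  w != 0 -> wave_poly m w p = 0 -> p = 0.
Proof.
case: w => a b w0 L0; apply/eqP/negPn/negP => p0.
have c0 : (b / 2 +i* (a / 2)) != 0.
  move: w0; rewrite !eq_complex /= !mulf_eq0 invr_eq0 pnatr_eq0 !orbF.
  by rewrite andbC.
have sp : (0 < size p)%N by rewrite size_poly_gt0.
(* As deg p = [size p] - 1, this is the coefficient of degree deg p + 2, reached only by the product
   of the leading terms of [phase_poly w] and [p]. *)
have := congr1 (fun q : {poly _} => q`_(size p).+1) L0.
have lc0 : p`_(size p).-1 != 0 by rewrite -[_`_ _]/(lead_coef p) lead_coef_eq0.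
rewrite /wave_poly /phase_poly coef0 mulrDl -scalerAl !coefD coefXM /=.
rewrite coefB coefMn coefXM coefZ coefXnM mul_polyC coefZ.
have pS j : (size p <= j)%N -> p`_j = 0 by move=> ?; rewrite nth_default.
rewrite subSS subn1 (gtn_eqF sp) ltnS ltnNge sp /= coef_deriv (prednK sp).
rewrite (pS (size p)) ?(pS (size p).+1) //.
rewrite !mul0rn mulr0 subrr add0r addr0.
by move/eqP; rewrite mulf_eq0 (negPf c0) (negPf lc0).
Qed.

(** For w = 0 the operator sends X^j to (j - m) X^(j+1): m = r + s kills the top monomial, and the
    others move up one degree. *)
Lemma wave_poly0_size (R : realType) (r s : nat) (q : {poly R[i]}) :
  (size q <= s.+1)%N ->
  exists2 q' : {poly R[i]}, (size q' <= s)%N &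
   wave_poly (r + s) 0 ('X^r * q) = 'X^(r.+1) * q'.
Proof.
move=> sq; exists ('X * q^`() - q *+ s).
  apply/leq_sizeP => j; rewrite leq_eqVlt => /orP[/eqP<-|sj].
    rewrite coefB coefMn coefXM coef_deriv.
    by case: s {sq} => [|s] /=; rewrite ?mulr0n ?subrr // subr0.
  rewrite coefB coefMn coefXM coef_deriv; case: j sj => // j sj /=.
  by rewrite !nth_default ?mul0rn ?subrr // (leq_trans sq).
rewrite /wave_poly phase_poly0 mul0r addr0.
have XD : 'X * ('X^r)^`() = 'X^r *+ r :> {poly R[i]}.
  by rewrite derivXn; case: r => [|r]; rewrite ?mulr0 // mulrnAr -exprS.
rewrite derivM exprS -mulrA; congr (_ * _).
rewrite mulrDr mulrA XD mulrnAl [X in _ + X - _]mulrCA.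
by rewrite mulrnDr opprD addrACA subrr add0r -mulrnAr -mulrBr.
Qed.

(** Polynomial coefficients make the induction possible: the operators do not preserve constant
    ones. *)
Lemma expi_circle_independent (R : realType) (n : nat) (w : 'I_n -> R[i])
    (p : 'I_n -> {poly R[i]}) : injective w ->
  (forall t, \sum_(i < n) (p i).[expi t] * expi (circle_phase (w i) t) = 0) ->
  forall i, p i = 0.
Proof.
elim: n w p => [|n IH] w p winj p0; first by case.
wlog w0 : w winj p0 / w ord0 = 0 => [shift|].
  apply: (shift (fun i => w i - w ord0)); last exact: subrr.
    by move=> i j /addIr/winj.
  move=> t; apply: (mulfI (expi_neq0 (circle_phase (w ord0) t))).
  rewrite mulr0 -[RHS](p0 t) mulr_sumr; apply: eq_bigr => i _.
  by rewrite mulrCA -expiD -circle_phaseD addrC subrK.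
(* The span of the exponents of [p ord0] shrinks with each [wave_poly]. *)
have tail0 s r (q : {poly R[i]}) : (size q <= s)%N -> p ord0 = 'X^r * q ->
    forall i, p (lift ord0 i) = 0.
  elim: s r q p p0 => [|s IHs] r q p p0.
    (* The first term has vanished, and the induction on the number of terms handles the others. *)
    rewrite leqn0 size_poly_eq0 => /eqP-> pq.
    apply: (IH (w \o lift ord0)) => [|t].
      by move=> i j /= /winj /lift_inj.
    by rewrite -[RHS](p0 t) big_ord_recl pq mulr0 horner0 mul0r add0r.
  move=> sq pq i.
  have [q' sq' Lq] := wave_poly0_size r sq.
  (* Injectivity of [w] makes this exponent differ from [w ord0], which is 0, so the operator is
     injective on this term. *)
  apply: (@wave_poly_eq0 _ (r + s) (w (lift ord0 i))).
    by rewrite -w0 (inj_eq winj).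
  apply: (IHs r.+1 q' (fun i => wave_poly (r + s) (w i) (p i))) => //.
    exact: wave_poly_relation.
  by rewrite w0 pq.
have {}tail0 := tail0 _ 0%N _ (leqnn _) (esym (mul1r _)).
move=> i; have [j ->|->] := unliftP ord0 i; first exact: tail0.
apply: horner_expi_eq0 => t; move: (p0 t).
rewrite big_ord_recl big1 ?addr0 => [|j _]; last by rewrite tail0 horner0 mul0r.
by rewrite w0 circle_phase0 expi0 mulr1.
Qed.

(** * Euclidean geometry: a great circle that separates the scatterers *)

Lemma dotpC (R : realType) (d : nat) (x y : 'rV[R]_d) : dotp x y = dotp y x.
Proof. by apply: eq_bigr => i _; rewrite mulrC. Qed.

Lemma dotpDl (R : realType) (d : nat) (x y z : 'rV[R]_d) :
  dotp (x + y) z = dotp x z + dotp y z.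
Proof. by rewrite -big_split; apply: eq_bigr => i _; rewrite mxE mulrDl. Qed.

Lemma dotpZl (R : realType) (d : nat) (a : R) (x y : 'rV[R]_d) :
  dotp (a *: x) y = a * dotp x y.
Proof. by rewrite mulr_sumr; apply: eq_bigr => i _; rewrite mxE mulrA. Qed.

Lemma poly_nonroot (R : realType) (p : {poly R}) :
  p != 0 -> exists a, ~~ root p a.
Proof.
move=> /eqP p0; apply: contrapT => /forallNP noroot; apply: p0.
apply: (@poly_eq0_inj _ p (fun k => k%:R)) => [j k /eqP|k].
  by rewrite eqr_nat => /eqP.
exact/rootP/negPn/negP/noroot.
Qed.

(** Any non-root of the product of the nonzero polynomials a_i + b_i X serves as c. *)
Lemma separating_slope (R : realType) (I : finType) (a b : I -> R) :
  exists c, forall i, a i + c * b i = 0 -> a i = 0 /\ b i = 0.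
Proof.
pose q i : {poly R} := (a i)%:P + b i *: 'X.
have q0 i : q i = 0 -> a i = 0 /\ b i = 0.
  move=> qi; have := congr1 (fun p : {poly R} => (p`_0, p`_1)) qi.
  by rewrite /q !(coefD, coefC, coefZ, coefX) /= mulr0 mulr1 addr0 add0r => -[-> ->].
have [|c nr] := @poly_nonroot R (\prod_(i | q i != 0) q i).
  by apply/prodf_neq0.
exists c => i e; apply: q0; apply/eqP/negPn/negP => qi.
case/negP: nr; rewrite rootE horner_prod (bigD1 i) //= mulf_eq0.
by rewrite /q hornerD hornerC hornerZ hornerX [b i * c]mulrC e eqxx.
Qed.

Lemma separating_plane (R : realType) (d n : nat) (y : 'I_n -> 'rV[R]_d) :
  d = 2%N \/ d = 3%N -> injective y ->
  exists u v : 'rV[R]_d,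
    [/\ dotp u u = 1, dotp v v = 1, dotp u v = 0 &
        injective (fun j => (dotp u (y j), dotp v (y j)))].
Proof.
move=> hd yinj; case: hd => ?; subst d.
  exists (\row_j (j == 0)%:R), (\row_j (j == 1)%:R).
  rewrite /dotp !big_ord_recl !big_ord0 !mxE /=.
  split; [ring..|]; move=> i j.
  rewrite !big_ord_recl !big_ord0 !mxE /= !mul1r !mul0r !addr0 !add0r => -[e0 e1].
  apply: yinj; apply/rowP => k.
  have [->|->] : k = ord0 \/ k = lift ord0 ord0 => //.
  by case: k => -[|[|]] // ?; [left|right]; apply: val_inj.
(* The plane is spanned by (1, c, 0), normalised by r, and the third basis vector; c is chosen so
   that (1, c, 0) is orthogonal to a difference of two points only if their first two coordinates
   agree. *)
have [c sep] := @separating_slope R ('I_n * 'I_n)%type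
  (fun ij => y ij.1 0 0 - y ij.2 0 0) (fun ij => y ij.1 0 1 - y ij.2 0 1).
pose r := (Num.sqrt (1 + c ^+ 2))^-1.
have pos : 0 < 1 + c ^+ 2 by rewrite ltr_pwDl ?sqr_ge0.
have r0 : r != 0 by rewrite invr_eq0 sqrtr_eq0 -ltNge.
have rr : r * r * (1 + c * c) = 1.
  rewrite -!expr2 /r exprVn sqr_sqrtr ?ltW // mulVf ?gt_eqF //.
exists (\row_j (if j == 0 then r else if j == 1 then r * c else 0)).
exists (\row_j (j == 2%:R)%:R).
rewrite /dotp !big_ord_recl !big_ord0 !mxE /=.
split; [by rewrite -[RHS]rr; ring | ring | ring |].
move=> i j.
rewrite !big_ord_recl !big_ord0 !mxE /= !mul1r !mul0r !addr0 !add0r => -[e0 e2].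
have one : 1 = lift ord0 ord0 :> 'I_3 by apply: val_inj.
have [] := sep (i, j).
  rewrite /= one; apply: (mulfI r0); rewrite mulr0.
  move/eqP: e0; rewrite -subr_eq0 => /eqP <-; ring.
rewrite /= one => /eqP; rewrite subr_eq0 => /eqP y0 /eqP; rewrite subr_eq0 => /eqP y1.
apply: yinj; apply/rowP => m.
have [->|->|->] : [\/ m = ord0, m = lift ord0 ord0 |
                   m = lift ord0 (lift ord0 ord0)] => //.
by case: m => -[|[|[|]]] // ?; [constructor 1|constructor 2|constructor 3]; apply: val_inj.
Qed.

Lemma sphere_circle (R : realType) (d n : nat) (kappa : R)
    (y : 'I_n -> 'rV[R]_d) :
  d = 2%N \/ d = 3%N -> 0 < kappa -> injective y ->
  exists (l : R -> 'rV[R]_d) (w : 'I_n -> R[i]),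
    [/\ injective w, forall t, esphere kappa (l t) &
        forall t j, - dotp (l t) (y j) = circle_phase (w j) t].
Proof.
move=> hd k0 yinj; have [u [v [uu vv uv inj]]] := separating_plane hd yinj.
exists (fun t => kappa *: (cos t *: u + sin t *: v)).
(* The sign matches the exponent -l.y_j of the amplitude. *)
exists (fun j => (- kappa * dotp u (y j)) +i* (- kappa * dotp v (y j))).
split=> [i j [/mulfI e1 /mulfI e2]|t|t j].
- by apply: inj; rewrite e1 ?e2 // oppr_eq0 gt_eqF.
- rewrite /esphere /enorm /=.
  set s := _ + _; have -> : dotp (kappa *: s) (kappa *: s) = kappa ^+ 2.
    rewrite dotpZl dotpC dotpZl dotpDl !dotpZl ![dotp _ s]dotpC !dotpDl !dotpZl.
    rewrite uu vv uv [dotp v u]dotpC uv.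
    have := cos2Dsin2 t => /(canRL (addrK _)) cos2; ring: cos2.
  by rewrite sqrtr_sqr gtr0_norm.
- by rewrite dotpZl dotpDl !dotpZl /circle_phase /=; ring.
Qed.

(** * From a vanishing amplitude to the absence of scatterers *)

Theorem theorem3p2 (R : realType) (d : nat) (hd : d = 2%N \/ d = 3%N)
    (E kappa : R) (hE : 0 < E) (hkappa : kappa = Num.sqrt E)
    (k : 'rV[R]_d) (hk : esphere kappa k)
    (n : nat) (alpha : 'I_n -> R[i]) (y : 'I_n -> 'rV[R]_d)
    (hy : injective y) (hA : \det (scat_mx kappa alpha y) != 0)
    (hf : forall l : 'rV[R]_d, esphere kappa l ->
      scat_amp kappa alpha y k l = 0) :
  n = 0%N.
Proof.
have kappa0 : 0 < kappa by rewrite hkappa sqrtr_gt0.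
have [l [w [winj lS lw]]] := sphere_circle hd kappa0 hy.
have cst0 : amp_const d kappa / ((2 * pi) ^+ d)%:C != 0.
  rewrite mulf_neq0 //; last first.
    by rewrite invr_eq0 eq_complex /= eqxx andbT expf_neq0 // mulf_neq0 ?pnatr_eq0 //
      gt_eqF ?pi_gt0.
  rewrite /amp_const !mulf_neq0 ?expf_neq0 ?mulf_neq0 ?expi_neq0 //.
  - rewrite oppr_eq0 mulf_neq0 // eq_complex /= ?eqxx ?oner_eq0 ?andbF //.
    by rewrite andbT gt_eqF ?pi_gt0.
  - by rewrite eq_complex /= eqxx andbT sqrtr_eq0 -ltNge mulr_gt0 ?pi_gt0.
  - by rewrite eq_complex /= eqxx andbT gt_eqF // powR_gt0.
pose q := scat_coef kappa alpha y k.
have q0 : q = 0.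
  apply/colP => j; rewrite [RHS]mxE.
  suff : (q j 0)%:P = 0 by move/eqP; rewrite polyC_eq0 => /eqP.
  (* The q_j enter as constant polynomials; the nonzero prefactor of the amplitude cancels. *)
  apply: (expi_circle_independent (p := fun j => (q j 0)%:P) winj) => t.
  apply: (mulfI cst0); rewrite mulr0 -[RHS](hf _ (lS t)) /scat_amp.
  by congr (_ * _); apply: eq_bigr => i _; rewrite hornerC lw.
have := scat_coefP k hA; rewrite -/q q0 mulmx0 => /matrixP Aq.
apply/eqP/negPn/negP; rewrite -lt0n => n0.
(* With q = 0, the first row would read 0 = -exp(ik.y_0), where y_0 is the point of index 0. *)
have := Aq (Ordinal n0) 0.
by rewrite !mxE => /esym/eqP; rewrite oppr_eq0 (negPf (expi_neq0 _)).
Qed.
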